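(* Let $\mathcal{L}$ be a complete modular lattice and let $\mathfrak{m}$ be a submonoid with zero of $\mathrm{End}_{lin}(\mathcal{L})$ that is closed under complements. Suppose $\mathcal{L}$ is $\mathfrak{m}$-endoregular. The following conditions are equivalent: (a) Any two idempotents of $\mathfrak{m}$ commute. (b) $C(\mathcal{L})$ is Boolean.
   Context: $\mathbf{0},\mathbf{1}$ denote the least and greatest elements; $[a,b]=\{x: a\le x\le b\}$. An element $x$ has a complement if there is $x'$ with $x\wedge x'=\mathbf{0}$, $x\vee x'=\mathbf{1}$; $C(\mathcal{L})$ is the set of elements of $\mathcal{L}$ having a complement. (Under the hypotheses $C(\mathcal{L})$ is a sublattice of $\mathcal{L}$; ''$C(\mathcal{L})$ is Boolean'' means this sublattice is a Boolean algebra.) Linear morphism: a map $\varphi:\mathcal{L}\to\mathcal{L}'$ between bounded lattices is linear if there exist $\ker_\varphi\in\mathcal{L}$ and $a'\in\mathcal{L}'$ such that (1) $\varphi(x)=\varphi(x\vee\ker_\varphi)$ for all $x$; (2) $\varphi$ restricts to a lattice isomorphism $[\ker_\varphi,\mathbf{1}]\to[\mathbf{0},a']$ (so $a'=\varphi(\mathbf{1})$). $\mathrm{End}_{lin}(\mathcal{L})$ is the monoid of linear morphisms $\mathcal{L}\to\mathcal{L}$ under composition; its zero is the constant map $\mathbf{0}$. A submonoid with zero contains the identity and the zero morphism. For $x$ with complement $x'$, the projection $\pi_x$ (with respect to $x'$) is $\pi_x(a)=(a\vee x')\wedge x$, viewed with codomain $\mathcal{L}$ or $[\mathbf{0},x]$;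 $\iota_x:[\mathbf{0},x]\to\mathcal{L}$ is the inclusion. $\mathfrak{m}$ is closed under complements if for every $\varphi\in\mathfrak{m}$ and all $x,y\in C(\mathcal{L})$ such that $\varphi$ restricts to an isomorphism $\varphi|_x:[\mathbf{0},x]\to[\mathbf{0},y]$, one has $\iota_x(\varphi|_x)^{-1}\pi_y\in\mathfrak{m}$ (for every choice of complement of $y$ defining $\pi_y$). $\mathcal{L}$ is $\mathfrak{m}$-endoregular if for each $\varphi\in\mathfrak{m}$ there is $\psi\in\mathfrak{m}$ with $\varphi=\varphi\psi\varphi$. *)

(* Defs.v *)
From mathcomp Require Import all_boot all_order.
From mathcomp Require Import boolp classical_sets functions.

Set Implicit Arguments.
Unset Strict Implicit.
Unset Printing Implicit Defensive.

Import Order.TTheory.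

(* Both order_scope and classical_set_scope use `&` and `|`: below these are
   always the lattice operations, and sets are delimited by %classic. *)
Local Open Scope order_scope.

Section Lattices.
Context {d : Order.disp_t} {L : tbLatticeType d}.
Implicit Types (a b x y : L) (S : set L).

Definition modular_lattice := forall x y z : L,
  x <= z -> x `|` (y `&` z) = (x `|` y) `&` z.

Definition complete_lattice := forall S, (supremums S !=set0)%classic.

Definition segment a b : set L := [set x | a <= x <= b]%classic.

Definition complement_of x x' := x `&` x' = \bot /\ x `|` x' = \top.

Definition complemented : set L := [set x | exists x', complement_of x x']%classic.

Record boolean_sublattice S : Prop := {
  bsub_bot : S \bot;
  bsub_top : S \top;
  bsub_meet : forall x y, S x -> S y -> S (x `&` y);
  bsub_join : forall x y, S x -> S y -> S (x `|` y);
  bsub_distr : forall x y z, S x -> S y -> S z ->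
    x `&` (y `|` z) = (x `&` y) `|` (x `&` z);
  bsub_compl : forall x, S x -> exists2 x', S x' & complement_of x x'
}.

(* pi_x with respect to the complement x', viewed with codomain L. *)
Definition projection x x' : L -> L := fun a => (a `|` x') `&` x.

End Lattices.

Arguments modular_lattice {d} L.
Arguments complete_lattice {d} L.
Arguments complemented {d} L.

Section Morphisms.
Context {d d' : Order.disp_t} {L : tbLatticeType d} {L' : tbLatticeType d'}.

(* f restricts to a lattice isomorphism from [a, b] onto [a', b']; intervals
   are sublattices, so their operations are those of L and L'. *)
Definition segment_iso (a b : L) (a' b' : L') (f : L -> L') : Prop :=
  set_bij (segment a b) (segment a' b') f /\
  (forall x y, segment a b x -> segment a b y ->
     f (x `&` y) = f x `&` f y /\ f (x `|` y) = f x `|` f y).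

Definition linear_morphism (f : L -> L') : Prop :=
  exists (k : L) (a' : L'),
    (forall x, f x = f (x `|` k)) /\ segment_iso k \top \bot a' f.

End Morphisms.

Section Submonoids.
Context {d : Order.disp_t} {L : tbLatticeType d}.
Implicit Type m : set (L -> L).

Record submonoid_with_zero m : Prop := {
  smz_linear : forall f, m f -> linear_morphism f;
  smz_id : m id;
  smz_zero : m (fun=> \bot);
  smz_comp : forall f g, m f -> m g -> m (f \o g)
}.

(* The inverse of the restriction of f to A (a function on L, relevant on the
   image of A) is rendered by the library's partial inverse 'pinv_. Since pi_y
   takes values in [\bot, y], the composite depends only on the restriction of
   f to [\bot, x]. *)
Definition closed_under_complements m : Prop :=
  forall (f : L -> L) (x y : L), m f -> complemented L x -> complemented L y ->
    segment_iso \bot x \bot y f ->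
    forall y', complement_of y y' ->
      m (('pinv_(fun=> \bot) (segment \bot x) f) \o projection y y').

Definition endoregular m : Prop :=
  forall f, m f -> exists2 g, m g & f = f \o g \o f.

End Submonoids.

(* Main.v *)
Require Import Defs.
From mathcomp Require Import all_boot all_order.
From mathcomp Require Import boolp classical_sets functions.

Set Implicit Arguments.
Unset Strict Implicit.
Unset Printing Implicit Defensive.

Import Order.TTheory.
Local Open Scope order_scope.

(** Both conditions say that projections onto complemented elements are meets
    on [complemented L]: [(b `|` a') `&` a = a `&` b] for all complemented
    [a], [b] and every complement [a'] of [a].

    An idempotent linear map [e] is a projection: its image is some segment
    [[\bot, a]], which it fixes pointwise, its kernel [k] is a complement of
    [a], and modularity forces [e x = (x `|` k) `&` a]
    ([linear_idempotentP], [projection_unique]). Conversely, closure under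
    complements applied to the identity puts every projection in [m].

    If idempotents commute, evaluating [pi_x \o pi_y = pi_y \o pi_x] at [\top]
    gives an element which is below both [x] and [y], whence
    [pi_x y = x `&` y]. From this [x' `|` y'] complements [x `&` y], so that
    complemented elements form a sublattice, and distributivity is the
    fact that [pi_x] preserves joins.

    If [complemented L] is Boolean, distributivity gives [pi_a b = a `&` b] at
    once. For idempotents [e = pi_a], [f = pi_b] with kernels [k] and [l], both
    [e \o f] and [f \o e] then fix the elements below [a `&` b] and kill
    [k `|` l], hence both are the projection onto [a `&` b] along [k `|` l].
    This covers arguments of [L] outside [complemented L]. *)

Section Linear.
Context {d d' : Order.disp_t} {L : tbLatticeType d} {L' : tbLatticeType d'}.

(** Joining with the kernel brings all arguments into the segment on which the
    map is a lattice morphism. *)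
Lemma linear_morphism_join (f : L -> L') :
  linear_morphism f -> {morph f : x y / x `|` y}.
Proof.
move=> [k [a' [fk [_ fmor]]]] x y.
have inK z : segment k \top (z `|` k) by rewrite /segment /= leUr lex1.
by rewrite (fk x) (fk y) -(fmor _ _ (inK x) (inK y)).2 joinACA joinxx -fk.
Qed.

End Linear.

Section Projections.
Context {d : Order.disp_t} {L : tbLatticeType d}.
Implicit Types (a b c k x y z : L) (f e : L -> L).

Lemma projection_id a k z :
  modular_lattice L -> complement_of a k -> z <= a -> projection a k z = z.
Proof. by move=> mL [akm _] za; rewrite /projection -mL// meetC akm joinx0. Qed.

Lemma projection_kernel a k : complement_of a k -> projection a k k = \bot.
Proof. by move=> [akm _]; rewrite /projection joinxx meetC. Qed.

Lemma projection_top a k : projection a k \top = a.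
Proof. by rewrite /projection join1x meet1x. Qed.

Lemma projection_idem a k : modular_lattice L -> complement_of a k ->
  projection a k \o projection a k = projection a k.
Proof.
by move=> mL ak; apply/funext => x /=; rewrite projection_id// leIr.
Qed.

(** Modularity splits [x `|` k] as the join of its part below [c] with [k], so
    the two hypotheses on [g] determine its value. *)
Lemma projection_unique (g : L -> L) c k : modular_lattice L ->
  {morph g : x y / x `|` y} -> (forall z, z <= c -> g z = z) ->
  g k = \bot -> k `|` c = \top -> g = projection c k.
Proof.
move=> mL gU gc gk kc; apply/funext => x.
have -> : g x = g (x `|` k) by rewrite gU gk joinx0.
have {1}-> : x `|` k = k `|` (c `&` (x `|` k)) by rewrite mL ?leUr// kc meet1x.
by rewrite gU gk join0x gc ?leIl// /projection meetC.
Qed.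

(** The segment onto which [e] maps consists of fixed points, which gives [a].
    The kernel [k] is disjoint from [a] because a fixed point killed by [e] is
    [\bot], and joins with [a] to [\top] because [e] is injective above [k]. *)
Lemma linear_idempotentP e : modular_lattice L -> linear_morphism e ->
  e \o e = e -> exists a k, complement_of a k /\ e = projection a k.
Proof.
move=> mL elin ee; have eU := linear_morphism_join elin.
have eeE x : e (e x) = e x := congr1 (@^~ x) ee.
have [k [a [ek [[efun einj esurj] _]]]] := elin.
have inK z : k <= z -> segment k \top z by rewrite /segment /= lex1 => ->.
have efix z : z <= a -> e z = z.
  move=> za; have /esurj[u _ <-] : segment \bot a z by rewrite /segment /= le0x.
  exact: eeE.
have ek0 : e k = \bot.
  have /esurj[u /andP[ku _] eu] : segment \bot a \bot.
    by rewrite /segment /= !le0x.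
  by have := eU u k; rewrite (join_l ku) eu join0x.
have ea : e \top = a.
  have /andP[_ e1a] := efun \top (inK _ (lex1 k)).
  apply/le_anti; rewrite e1a /= -{1}(efix a)//.
  by have := eU a \top; rewrite joinx1 => ->; rewrite leUl.
(* [a `|` k] and [\top] have the same image, and both lie above [k] *)
have ak1 : k `|` a = \top.
  apply: einj; rewrite ?inE; [exact/inK/leUl | exact/inK/lex1 |].
  by rewrite eU ek0 join0x -ea eeE.
have eP := projection_unique mL eU efix ek0 ak1.
exists a, k; split=> //; split; last by rewrite joinC.
by rewrite -ek0 eP /projection joinxx meetC.
Qed.

(** Recovers [b `|` k] from its part below [a], by modularity. It reduces
    [(a `&` b) `|` (k `|` l) = \top] to [b `|` l = \top]. *)
Lemma joinI_projection a k b : modular_lattice L -> complement_of a k ->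
  projection a k b = a `&` b -> (a `&` b) `|` k = b `|` k.
Proof.
move=> mL [_ ak1] <-; rewrite /projection joinC [_ `&` a]meetC.
by rewrite mL ?leUr// joinC ak1 meet1x.
Qed.

Lemma complement_ofC x y : complement_of x y -> complement_of y x.
Proof. by case=> xy0 xy1; split; [rewrite meetC | rewrite joinC]. Qed.

Lemma complement_complemented x y : complement_of x y -> complemented L y.
Proof. by move=> /complement_ofC yx; exists x. Qed.

End Projections.

Section Submonoid.
Context {d : Order.disp_t} {L : tbLatticeType d} (m : set (L -> L)).
Hypothesis mL : modular_lattice L.
Hypothesis mS : submonoid_with_zero m.

(** A projection is the quasi-inverse that closure under complements attaches
    to the identity, restricted to [[\bot, y]]. *)
Lemma projection_in (y y' : L) : closed_under_complements m ->
  complement_of y y' -> m (projection y y').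
Proof.
move=> mC yy'.
have idiso : segment_iso \bot y \bot y (@id L).
  by split=> //; split=> // z zy; exists z.
have yC : complemented L y by exists y'.
have := mC id y y (smz_id mS) yC yC idiso y' yy'.
congr m; apply/funext => x /=.
have inj : {in segment \bot y &, injective (@id L)} by [].
have /(pinvKV (fun=> \bot) inj) : projection y y' x \in segment \bot y.
  by rewrite inE /segment /= le0x leIr.
by [].
Qed.

Section Commuting.
Hypothesis mC : closed_under_complements m.
Hypothesis comm : forall e f : L -> L, m e -> m f -> e \o e = e ->
  f \o f = f -> e \o f = f \o e.

Let projectionC x x' y y' (z : L) : complement_of x x' -> complement_of y y' ->
  projection x x' (projection y y' z) = projection y y' (projection x x' z).
Proof.
move=> xx' yy'.
by have /(congr1 (@^~ z)) := comm (projection_in mC xx') (projection_in mC yy')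
  (projection_idem mL xx') (projection_idem mL yy').
Qed.

Lemma projection_meet_comm (x x' y y' : L) :
  complement_of x x' -> complement_of y y' -> projection x x' y = x `&` y.
Proof.
move=> xx' yy'; apply/le_anti/andP; split; last first.
  by rewrite lexI leIl andbT leIxr// leUl.
(* [pi_x y] is the value of both composites at [\top], hence also below [y] *)
rewrite lexI leIr /= -{1}(projection_top y y') (projectionC _ xx' yy').
exact: leIr.
Qed.

(** The composite of the two projections is idempotent, with image below
    [x `&` y] and kernel [x' `|` y'], so these are complements. *)
Lemma complement_meet_comm (x x' y y' : L) :
  complement_of x x' -> complement_of y y' ->
  complement_of (x `&` y) (x' `|` y').
Proof.
move=> xx' yy'; split; last first.
  rewrite joinA (joinI_projection mL xx' (projection_meet_comm xx' yy')).
  by rewrite joinAC yy'.2 join1x.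
(* an element [z] below both sides is fixed by [pi_x \o pi_y] and killed by it *)
set z := _ `&` _.
have zx : z <= x by rewrite leIxl// leIl.
have zy : z <= y by rewrite leIxl// leIr.
have zk : z <= x' `|` y' by rewrite leIr.
have pxU := linear_morphism_join (smz_linear mS (projection_in mC xx')).
have pyU := linear_morphism_join (smz_linear mS (projection_in mC yy')).
have proj0 (a a' : L) : complement_of a a' -> projection a a' \bot = \bot.
  by move=> aa'; apply: projection_id; rewrite ?le0x.
have kill : projection x x' (projection y y' (x' `|` y')) = \bot.
  rewrite pyU pxU projectionC// !projection_kernel// !proj0//.
  by rewrite joinxx.
rewrite -(projection_id mL xx' zx) -(projection_id mL yy' zy).
apply/eqP; rewrite -lex0 -kill -(join_r zk) (pyU z) pxU.
exact: leUl.
Qed.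

Lemma boolean_of_commuting : boolean_sublattice (complemented L).
Proof.
split.
- by exists \top; split; rewrite ?meet0x ?join0x.
- by exists \bot; split; rewrite ?meetx0 ?joinx0.
- by move=> x y [x' xx'] [y' yy']; exists (x' `|` y'); exact: complement_meet_comm.
- move=> x y [x' xx'] [y' yy']; exists (x' `&` y'); apply: complement_ofC.
  by apply: complement_meet_comm; exact: complement_ofC.
- move=> x y z [x' xx'] [y' yy'] [z' zz'].
  have yz : complement_of (y `|` z) (y' `&` z').
    apply: complement_ofC; apply: complement_meet_comm; exact: complement_ofC.
  rewrite -(projection_meet_comm xx' yy') -(projection_meet_comm xx' zz').
  rewrite -(projection_meet_comm xx' yz).
  exact: (linear_morphism_join (smz_linear mS (projection_in mC xx'))).
- by move=> x [x' xx']; exists x' => //; exact: complement_complemented xx'.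
Qed.

End Commuting.

Section Boolean.
Hypothesis cB : boolean_sublattice (complemented L).

Lemma projection_meet_boolean (a k b : L) :
  complement_of a k -> complemented L b -> projection a k b = a `&` b.
Proof.
move=> ak bC; rewrite /projection meetC (bsub_distr cB) ?ak.1 ?joinx0//.
  by exists k.
exact: complement_complemented ak.
Qed.

(** The right-hand side is symmetric in the two projections, up to
    commutativity of meet and join, so this forces [e] and [f] to commute. *)
Lemma projection_comp_boolean (e f : L -> L) (a k b l : L) : m e -> m f ->
  complement_of a k -> complement_of b l ->
  e = projection a k -> f = projection b l ->
  e \o f = projection (a `&` b) (k `|` l).
Proof.
move=> me mf ak bl eE fE.
have eU := linear_morphism_join (smz_linear mS me).
have fU := linear_morphism_join (smz_linear mS mf).
have bC : complemented L b by exists l.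
have kC := complement_complemented ak.
have ekill z : z <= k -> e z = \bot.
  move=> zk; apply/eqP; rewrite -lex0 -(projection_kernel ak) -eE.
  by rewrite -[in leRHS](join_r zk) eU leUl.
apply: (projection_unique mL).
- by move=> x y /=; rewrite fU eU.
- move=> z; rewrite lexI => /andP[za zb] /=.
  by rewrite fE (projection_id mL bl zb) eE projection_id.
- rewrite /= fU eU {1}fE projection_meet_boolean// ekill ?leIr//.
  by rewrite fE projection_kernel// ekill ?le0x// joinxx.
- rewrite joinC joinA (joinI_projection mL ak (projection_meet_boolean ak bC)).
  by rewrite joinAC bl.2 join1x.
Qed.

Lemma commuting_of_boolean (e f : L -> L) : m e -> m f ->
  e \o e = e -> f \o f = f -> e \o f = f \o e.
Proof.
move=> me mf ee ff.
have [a [k [ak eE]]] := linear_idempotentP mL (smz_linear mS me) ee.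
have [b [l [bl fE]]] := linear_idempotentP mL (smz_linear mS mf) ff.
rewrite (projection_comp_boolean me mf ak bl eE fE).
by rewrite (projection_comp_boolean mf me bl ak fE eE) meetC joinC.
Qed.

End Boolean.

End Submonoid.

Theorem proposition3p31 (d : Order.disp_t) (L : tbLatticeType d)
    (m : set (L -> L)) :
  complete_lattice L -> modular_lattice L ->
  submonoid_with_zero m -> closed_under_complements m -> endoregular m ->
  (forall e f : L -> L, m e -> m f -> e \o e = e -> f \o f = f ->
     e \o f = f \o e)
  <-> boolean_sublattice (complemented L).
Proof.
move=> _ mL mS mC _; split; first exact: boolean_of_commuting mL mS mC.
by move=> cB e f; exact: commuting_of_boolean mL mS cB e f.
Qed.
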